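(* For $N\ge1$ let $c(N)$ be the number of distinct squares beginning in $D_\infty[1,N]$. Then for every $m\ge1$, $$c(N+1)-c(N)=\begin{cases}1,&2^m\le N<3\cdot2^{m-1};\\ 0,&3\cdot2^{m-1}\le N<2^{m+1}.\end{cases}$$ Moreover, the number of distinct cubes beginning in $D_\infty[1,N]$ is also $c(N)$.
   Context: Let $\sigma$ be the morphism on $\{a,b\}^*$ with $\sigma(a)=ab$, $\sigma(b)=aa$. The Doubling sequence is $D_\infty=x_1x_2x_3\cdots=\sigma^\infty(a)=abaaabab\cdots$, the infinite fixed point of $\sigma$ beginning with $a$. $D_\infty[1,N]=x_1\cdots x_N$. A square (resp. cube) is a word $\omega\omega$ (resp. $\omega\omega\omega$) with $\omega$ a nonempty word. A square or cube $u$ is said to begin in $D_\infty[1,N]$ if $u$ has an occurrence $x_{k}x_{k+1}\cdots x_{k+|u|-1}$ in $D_\infty$ with $1\le k\le N$ (the occurrence need not end within $D_\infty[1,N]$). Distinct means distinct as words. *)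

(* Defs.v *)
From HB Require Import structures.
From mathcomp Require Import all_boot all_order all_algebra finmap.
From mathcomp Require Import boolp classical_sets functions cardinality.

Set Implicit Arguments.
Unset Strict Implicit.
Unset Printing Implicit Defensive.

Local Open Scope classical_set_scope.

Inductive letter := La | Lb.

Definition is_La (x : letter) : bool := if x is La then true else false.
Definition letter_of_bool (t : bool) : letter := if t then La else Lb.
Lemma is_LaK : cancel is_La letter_of_bool. Proof. by case. Qed.
HB.instance Definition _ := Countable.copy letter (can_type is_LaK).

Notation word := (seq letter).

Definition sigma_letter (x : letter) : word :=
  match x with La => [:: La; Lb] | Lb => [:: La; La] end.
Definition sigma (w : word) : word := flatten (map sigma_letter w).

(* x_k for k >= 1, so indices start at 1. The word sigma^k(a) is a prefix of
   the infinite word and its length 2^k exceeds k.-1, hence the default letter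
   of nth is never used; x_0 is junk. See Doubling_prefix. *)
Definition Doubling (k : nat) : letter := nth La (iter k sigma [:: La]) k.-1.

(* The word x_k x_{k+1} ... x_{k+n-1}. *)
Definition Doubling_factor (k n : nat) : word :=
  [seq Doubling i | i <- iota k n].

Definition is_square (u : word) : Prop :=
  exists w : word, w <> [::] /\ u = w ++ w.
Definition is_cube (u : word) : Prop :=
  exists w : word, w <> [::] /\ u = w ++ w ++ w.

(* Only the starting position is bounded by N; the occurrence may extend
   beyond position N. *)
Definition begins_in (N : nat) (u : word) : Prop :=
  exists k : nat, 1 <= k <= N /\ u = Doubling_factor k (size u).

Definition squares_beginning (N : nat) : set word :=
  [set u | is_square u /\ begins_in N u].
Definition cubes_beginning (N : nat) : set word :=
  [set u | is_cube u /\ begins_in N u].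

(* fset_set A is empty when A is infinite, so these two numbers are meaningful
   only together with the finiteness of the corresponding sets. *)
Definition num_squares (N : nat) : nat := #|` fset_set (squares_beginning N)|.
Definition num_cubes (N : nat) : nat := #|` fset_set (cubes_beginning N)|.

Lemma sigma_cat (u v : word) : sigma (u ++ v) = sigma u ++ sigma v.
Proof. by rewrite /sigma map_cat flatten_cat. Qed.

Lemma size_sigma (w : word) : size (sigma w) = (size w).*2.
Proof. by rewrite /sigma; elim: w => //= x w IH; rewrite size_cat IH; case: x. Qed.

Lemma size_iter_sigma (n : nat) : size (iter n sigma [:: La]) = 2 ^ n.
Proof. by elim: n => //= n IH; rewrite size_sigma IH expnS mul2n. Qed.

Lemma prefix_iter_sigma (m n : nat) : m <= n ->
  prefix (iter m sigma [:: La]) (iter n sigma [:: La]).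
Proof.
have step k : prefix (iter k sigma [:: La]) (iter k.+1 sigma [:: La]).
  elim: k => // k /prefixP[v Ev]; apply/prefixP; exists (sigma v).
  by rewrite -[LHS]/(sigma (iter k.+1 sigma [:: La])) {1}Ev sigma_cat.
move=> /subnK <-; elim: (n - m) => [|k IH]; first exact: prefix_refl.
exact: prefix_trans IH (step _).
Qed.

Lemma Doubling_prefix (n : nat) :
  Doubling_factor 1 (2 ^ n) = iter n sigma [:: La].
Proof.
apply: (@eq_from_nth _ La); rewrite size_map size_iota ?size_iter_sigma //.
move=> i lt_i; rewrite (nth_map 0) ?size_iota // nth_iota // add1n /Doubling.
have lt_i' : i < size (iter i.+1 sigma [:: La]).
  by rewrite size_iter_sigma (leq_trans (ltnSn i)) // ltnW // ltn_expl.
have [le_in|lt_ni] := leqP i.+1 n.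
  by have /prefixP[v ->] := prefix_iter_sigma le_in; rewrite nth_cat lt_i'.
have /prefixP[v ->] := prefix_iter_sigma (ltnW lt_ni).
by rewrite nth_cat size_iter_sigma lt_i.
Qed.

(* Main.v *)
(* Writing n = 2 ^ l * q with q odd, x_n = a iff l is even.  Hence positions n
   and n + s * 2 ^ j carry the same letter unless 2 ^ j divides n.  Around a
   number 2 ^ l.+1 * t with t odd, a shift by an odd multiple of 2 ^ l changes
   the letter; such numbers are 2 ^ l.+2 apart, which forces every square to
   have half-length 2 ^ j and to begin after position 2 * 2 ^ j.  Its word is
   then determined by its position modulo 2 ^ j, so it already occurs at a
   unique position k with 2 * 2 ^ j < k <= 3 * 2 ^ j.  A cube of period 2 ^ j
   occurs at each of these k, and they give distinct words, so both counts are
   the number of such k <= N. *)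

Require Import Defs.
From mathcomp Require Import all_boot all_order all_algebra finmap.
From mathcomp Require Import boolp classical_sets functions cardinality.
From mathcomp Require Import zify.

Set Implicit Arguments.
Unset Strict Implicit.
Unset Printing Implicit Defensive.

Local Notation D := Doubling.

(** * Letters of the sequence in terms of the 2-adic valuation of their index *)

Lemma Doubling_nth e n : 0 < n <= 2 ^ e -> D n = nth La (iter e sigma [:: La]) n.-1.
Proof.
move=> /andP[n0 ne]; rewrite -Doubling_prefix (nth_map 0) ?nth_iota ?size_iota //; try lia.
by congr D; lia.
Qed.

Definition flip (x : letter) := if x is La then Lb else La.

(** Out of range, the default [La] of [nth] is the right letter too. *)
Lemma nth_sigma_even w i : nth La (sigma w) i.*2 = La.
Proof.
elim: w i => [|x w IH] [|i] //; first by case: x.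
by case: x; exact: IH.
Qed.

Lemma nth_sigma_odd w i :
  i < size w -> nth La (sigma w) i.*2.+1 = flip (nth La w i).
Proof.
elim: w i => [|x w IH] [|i] //; first by case: x.
by case: x; exact: IH.
Qed.

Lemma Doubling_double n : 0 < n -> D (2 * n) = flip (D n).
Proof.
move=> n0; have nle : n < 2 ^ n by exact: ltn_expl.
rewrite (@Doubling_nth n.+1) ?(@Doubling_nth n) ?expnS; try lia.
have -> : (2 * n).-1 = n.-1.*2.+1 by lia.
by rewrite iterS nth_sigma_odd // size_iter_sigma; lia.
Qed.

Lemma Doubling_odd n : odd n -> D n = La.
Proof.
move=> on; have nle : n < 2 ^ n by exact: ltn_expl.
rewrite (@Doubling_nth n.+1) ?expnS; try lia.
have -> : n.-1 = n./2.*2 by lia.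
by rewrite iterS nth_sigma_even.
Qed.

Lemma DoublingE l q : odd q -> D (2 ^ l * q) = letter_of_bool (~~ odd l).
Proof.
move=> oq; elim: l => [|l IH]; first by rewrite mul1n Doubling_odd.
rewrite expnS -mulnA Doubling_double; last by rewrite muln_gt0 expn_gt0 (odd_gt0 oq).
by rewrite IH /=; case: (odd l).
Qed.

Lemma odd_part n : 0 < n -> exists l q, odd q /\ n = 2 ^ l * q.
Proof.
elim/ltn_ind: n => n IH n0; have [on|en] := boolP (odd n).
  by exists 0, n; rewrite mul1n.
have [||l [q [oq nE]]] := IH n./2; try lia.
by exists l.+1, q; split; rewrite // expnS; lia.
Qed.

(** If n = 2 ^ l * q with q odd, then l < j, and the shift adds an even number to q: the valuation
    stays l. *)
Lemma Doubling_shift j n s :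
  ~~ (2 ^ j %| n) -> D (n + s * 2 ^ j) = D n.
Proof.
move=> ndvd; have n0 : 0 < n by case: n ndvd; rewrite ?dvdn0.
have [l [q [oq nE]]] := odd_part n0.
have lj : l < j.
  by rewrite ltnNge; apply: contra ndvd => jl; rewrite nE dvdn_mulr ?dvdn_exp2l.
have -> : n + s * 2 ^ j = 2 ^ l * (q + s * 2 ^ (j - l.+1) * 2).
  by rewrite nE -[in 2 ^ j](subnKC lj) expnD expnS; lia.
by rewrite nE !DoublingE //; lia.
Qed.

(** * Possible periods of squares *)

Lemma odd_multiple_in_window h k :
  0 < h -> exists t, odd t /\ k <= h * t < k + 2 * h.
Proof.
move=> h0; have := divn_eq k h; have := ltn_pmod k h0.
move: (k %/ h) (k %% h) => a b bh ->.
have [->|b0] := posnP b; have [oa|ea] := boolP (odd a).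
- by exists a; split=> //; nia.
- by exists a.+1; split; [rewrite /= ea|nia].
- by exists a.+2; split; [rewrite /= oa|nia].
- by exists a.+1; split; [rewrite /= ea|nia].
Qed.

Definition repeats k d n := forall i, i < n -> D (k + i) = D (k + i + d).

(* Adding or removing an odd multiple of 2 ^ l lowers the 2-adic valuation of
   2 ^ l.+1 * t from l.+1 to l, and so changes the letter. *)
Lemma repeats_avoids k l q n t : odd q -> odd t -> 0 < k ->
  repeats k (2 ^ l * q) n ->
  ~ (k <= 2 ^ l.+1 * t < k + n \/
     k + 2 ^ l * q <= 2 ^ l.+1 * t < k + 2 ^ l * q + n).
Proof.
move=> oq ot k0 rep; have := @DoublingE l.+1 t ot.
rewrite expnS -!(mulnC t) mulnA !(mulnC _ (2 ^ l)).
have h0 : 0 < 2 ^ l by rewrite expn_gt0.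
move=> E [] lt_t.
  have := rep (2 ^ l * (t * 2) - k); rewrite subnKC; last by lia.
  rewrite E -mulnDr DoublingE; last by lia.
  by rewrite /=; case: (odd l) => /= H; have := H ltac:(lia).
have := rep (2 ^ l * (t * 2) - 2 ^ l * q - k); rewrite subnKC; last by lia.
rewrite subnK; last by lia.
rewrite E -mulnBr DoublingE; last by nia.
by rewrite /=; case: (odd l) => /= H; have := H ltac:(lia).
Qed.

Lemma square_period k p : 0 < k -> 0 < p -> repeats k p p ->
  exists j, p = 2 ^ j /\ 2 * 2 ^ j < k.
Proof.
move=> k0 p0; have [j [q [oq ->]]] := odd_part p0 => rep.
have h0 : 0 < 2 ^ j by rewrite expn_gt0.
have av t : odd t -> ~ (k <= 2 * 2 ^ j * t < k + 2 * (2 ^ j * q)).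
  by move=> ot lt_t; apply: (repeats_avoids oq ot k0 rep); rewrite expnS; lia.
have q1 : q = 1.
  have [t [ot lt_t]] := @odd_multiple_in_window (2 * 2 ^ j) k ltac:(lia).
  have [//|qn1] := eqVneq q 1; exfalso.
  (* An odd q other than 1 is at least 3, so the square is long enough to cover the window
     containing t. *)
  by apply: (av t ot); nia.
exists j; rewrite q1 muln1; split=> //; rewrite ltnNge; apply/negP => le_k.
by apply: (av 1) => //; rewrite q1; lia.
Qed.

(** With d = 2 ^ l * q and q odd, l < j, so the range of length 2 * 2 ^ j contains an odd multiple
    of 2 ^ l.+1. This separates base powers of equal period. *)
Lemma no_short_repeats k d j :
  0 < k -> 0 < d < 2 ^ j -> ~ repeats k d (2 * 2 ^ j).
Proof.
move=> k0 /andP[d0]; have [l [q [oq ->]]] := odd_part d0 => ltj rep.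
have lj : l < j.
  rewrite -(@ltn_exp2l 2) //; apply: leq_ltn_trans ltj.
  by rewrite leq_pmulr // odd_gt0.
have [|t [ot lt_t]] := @odd_multiple_in_window (2 ^ l.+1) k.
  by rewrite expn_gt0.
have : 2 ^ l.+1 <= 2 ^ j by rewrite leq_exp2l.
by move=> le_lj; apply: (repeats_avoids oq ot k0 rep); left; lia.
Qed.

(** * Powers of period 2 ^ j and their bases *)

(** Only multiples of 2 ^ j could break the period. Those involved are 3, 4 and 5 times 2 ^ j, with
    valuations j, j + 2 and j of the same parity. *)
Lemma cube_at_base j k :
  2 * 2 ^ j < k <= 3 * 2 ^ j -> repeats k (2 ^ j) (2 * 2 ^ j).
Proof.
move=> lt_k i lt_i; have h0 : 0 < 2 ^ j by rewrite expn_gt0.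
have [/dvdnP[t tE]|nd] := boolP (2 ^ j %| k + i); last first.
  by have := @Doubling_shift j (k + i) 1 nd; rewrite mul1n.
have D4 : D (4 * 2 ^ j) = letter_of_bool (~~ odd j).
  by rewrite -[4]/(2 ^ 2) -expnD -[2 ^ _]muln1 DoublingE //= negbK.
have Do t' : odd t' -> D (t' * 2 ^ j) = letter_of_bool (~~ odd j).
  by move=> ot; rewrite mulnC DoublingE.
rewrite tE -[X in _ + X]mul1n -mulnDl.
have [->|->] : t = 3 \/ t = 4 by nia.
  by rewrite D4 Do.
by rewrite D4 Do.
Qed.

Lemma letter_at_multiple c j k i : 1 < c -> repeats k (2 ^ j) (c.-1 * 2 ^ j) ->
  i < c * 2 ^ j -> 2 ^ j %| k + i -> D (k + i) = letter_of_bool (~~ odd j).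
Proof.
move=> c1 rep lt_i /dvdnP[t tE]; have h0 : 0 < 2 ^ j by rewrite expn_gt0.
have Do t' : odd t' -> D (t' * 2 ^ j) = letter_of_bool (~~ odd j).
  by move=> ot; rewrite mulnC DoublingE.
have [ot|et] := boolP (odd t); first by rewrite tE Do.
have le_jc : 2 ^ j <= c.-1 * 2 ^ j by rewrite leq_pmull //; lia.
have cE : c * 2 ^ j = c.-1 * 2 ^ j + 2 ^ j by rewrite -mulSnr prednK //; lia.
(* For even t, the period links the position to an odd multiple of 2 ^ j: the next one from the
   first block, the previous one from later blocks. *)
have [lt_ij|le_ji] := ltnP i (2 ^ j).
  by rewrite rep; [rewrite tE -mulSnr Do | lia].
have := rep (i - 2 ^ j) ltac:(lia).
have -> : k + (i - 2 ^ j) = t.-1 * 2 ^ j by rewrite -subn1 mulnBl; lia.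
rewrite Do; last first.
  by case: t et tE => [|t] /= et tE; [lia | rewrite negbK in et].
by move=> ->; congr D; rewrite tE -subn1 mulnBl; lia.
Qed.

(* k is a base when 2 * 2 ^ j < k <= 3 * 2 ^ j for some j, which is then
   base_exp k: see is_baseP and base_expE. *)
Definition base_exp k := (trunc_log 2 k.-1).-1.
Definition is_base k := (2 < k) && (k <= 3 * 2 ^ base_exp k).
Definition base_power c k := Doubling_factor k (c * 2 ^ base_exp k).

(** The range goes beyond the bases, up to 4 * 2 ^ j, so that it also serves to show that a position
    is not a base. *)
Lemma base_expE k j : 2 * 2 ^ j < k <= 4 * 2 ^ j -> base_exp k = j.
Proof.
move=> lt_k; rewrite /base_exp (@trunc_log_eq 2 j.+1) // !expnS; lia.
Qed.

Lemma is_baseP k : reflect (exists j, 2 * 2 ^ j < k <= 3 * 2 ^ j) (is_base k).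
Proof.
apply: (iffP andP) => [[k2 le_k]|[j lt_k]].
  exists (base_exp k); rewrite le_k andbT -expnS /base_exp prednK.
    by have := @trunc_logP 2 k.-1 isT ltac:(lia); lia.
  by rewrite trunc_log_gt0; lia.
have h0 : 0 < 2 ^ j by rewrite expn_gt0.
by rewrite (@base_expE k j); lia.
Qed.

(** * Squares and cubes as repetitions between positions *)

Lemma Doubling_factor_eqP k k' n :
  Doubling_factor k n = Doubling_factor k' n <->
  forall i, i < n -> D (k + i) = D (k' + i).
Proof.
have nthE m i : i < n -> nth La (Doubling_factor m n) i = D (m + i).
  by move=> lt_i; rewrite (nth_map 0) ?size_iota // nth_iota.
split=> [E i lt_i|E]; first by rewrite -!nthE // E.
apply: (@eq_from_nth _ La); rewrite !size_map !size_iota // => i lt_i.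
by rewrite !nthE // E.
Qed.

Lemma size_Doubling_factor k n : size (Doubling_factor k n) = n.
Proof. by rewrite size_map size_iota. Qed.

Lemma Doubling_factorD k m n :
  Doubling_factor k (m + n) = Doubling_factor k m ++ Doubling_factor (k + m) n.
Proof. by rewrite /Doubling_factor iotaD map_cat. Qed.

Lemma repeatsP k d n :
  Doubling_factor k n = Doubling_factor (k + d) n <-> repeats k d n.
Proof.
split=> [/Doubling_factor_eqP E i lt_i|E]; first by rewrite E // addnAC.
by apply/Doubling_factor_eqP => i lt_i; rewrite E // addnAC.
Qed.

(* The words w ^ c beginning in x_1 ... x_N; the parameter p is the length of w. *)
Definition powers_beginning c N : set word :=
  [set u | exists k p, [/\ 0 < k <= N, 0 < p, u = Doubling_factor k (c * p)
                         & repeats k p (c.-1 * p)]]%classic.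

Lemma squares_beginningE N : squares_beginning N = powers_beginning 2 N.
Proof.
apply/seteqP; split=> u /=.
  move=> [[w [/eqP w0 uE]] [k [lt_k uF]]]; exists k, (size w).
  have szw : 0 < size w by rewrite lt0n size_eq0.
  have szu : size u = size w + size w by rewrite uE size_cat.
  rewrite mul2n -addnn mul1n -szu; split=> //.
  apply/repeatsP; move/eqP: uF; rewrite szu {1}uE Doubling_factorD.
  by rewrite eqseq_cat ?size_Doubling_factor // => /andP[/eqP<- /eqP<-].
move=> [k [p [lt_k p0 -> /repeatsP]]]; rewrite mul1n => rep; split.
  exists (Doubling_factor k p); split.
    by move=> /(congr1 size); rewrite size_Doubling_factor /=; lia.
  by rewrite mul2n -addnn Doubling_factorD -rep.
by exists k; rewrite size_Doubling_factor.
Qed.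

Lemma cubes_beginningE N : cubes_beginning N = powers_beginning 3 N.
Proof.
have E3 p : 3 * p = p + (p + p) by lia.
apply/seteqP; split=> u /=.
  move=> [[w [/eqP w0 uE]] [k [lt_k uF]]]; exists k, (size w).
  have szw : 0 < size w by rewrite lt0n size_eq0.
  have szu : size u = size w + (size w + size w) by rewrite uE !size_cat.
  rewrite E3 mul2n -addnn -szu; split=> //.
  apply/repeatsP; move/eqP: uF; rewrite szu {1}uE !Doubling_factorD.
  rewrite !eqseq_cat ?size_Doubling_factor // => /and3P[/eqP w1 /eqP w2 /eqP w3].
  by rewrite -w3 -w2 -w1.
move=> [k [p [lt_k p0 ->]]]; rewrite E3 => /repeatsP.
rewrite mul2n -addnn !Doubling_factorD => /eqP.
rewrite eqseq_cat ?size_Doubling_factor // => /andP[/eqP w2 /eqP w3]; split.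
  exists (Doubling_factor k p); split.
    by move=> /(congr1 size); rewrite size_Doubling_factor /=; lia.
  by rewrite -w3 -w2.
by exists k; rewrite !size_cat !size_Doubling_factor !Doubling_factorD.
Qed.

(** * Each power is the base power of exactly one base *)

Lemma base_power_mem c N k : 1 < c <= 3 -> k <= N -> is_base k ->
  powers_beginning c N (base_power c k).
Proof.
move=> c23 kN /is_baseP[j lt_k]; have h0 : 0 < 2 ^ j by rewrite expn_gt0.
exists k, (2 ^ j); rewrite /base_power (@base_expE k j); last by lia.
split=> //; [lia|].
by move=> i lt_i; apply: cube_at_base => //; nia.
Qed.

Lemma powers_beginning_base c N u : 1 < c <= 3 -> powers_beginning c N u ->
  exists2 k, is_base k && (k <= N) & u = base_power c k.
Proof.
move=> c23 [n [p [lt_n p0 -> rep]]].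
have [||j [pE lt_jn]] := @square_period n p _ p0; first by lia.
  (* A power with c > 1 starts with a square of the same period. *)
  by move=> i lt_i; apply: rep; nia.
move: p0 rep; rewrite pE {p pE} => h0 rep.
(* the representative of n modulo 2 ^ j in the interval ]2 * 2 ^ j, 3 * 2 ^ j] *)
pose k := 2 * 2 ^ j + ((n - 1) %% 2 ^ j).+1.
have lt_mod := ltn_pmod (n - 1) h0.
have lt_k : 2 * 2 ^ j < k <= 3 * 2 ^ j by rewrite /k; lia.
have [s nE] : exists s, n = k + s * 2 ^ j.
  exists ((n - 1) %/ 2 ^ j - 2); rewrite /k mulnBl.
  have := divn_eq (n - 1) (2 ^ j).
  have : 2 <= (n - 1) %/ 2 ^ j by rewrite leq_divRL //; lia.
  by move: ((n - 1) %/ 2 ^ j) => a; nia.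
exists k; first by rewrite (introT (is_baseP k)) /=; [lia | exists j].
rewrite /base_power (@base_expE k j); last by lia.
apply/Doubling_factor_eqP => i lt_i.
have repk : repeats k (2 ^ j) (c.-1 * 2 ^ j).
  by move=> i' lt_i'; apply: cube_at_base => //; nia.
(* Off the multiples of 2 ^ j the shift preserves letters; at the multiples both powers are forced
   to carry the letter of valuation j. *)
have [dv|ndv] := boolP (2 ^ j %| k + i); last first.
  by rewrite nE addnAC Doubling_shift.
have c1 : 1 < c by lia.
rewrite (letter_at_multiple c1 rep) ?(letter_at_multiple c1 repk) //.
by rewrite nE addnAC dvdn_addl // dvdn_mull.
Qed.

(** Equal words have equal lengths, hence the same j. The two bases then differ by less than 2 ^ j,
    and the equality is a repetition at too short a distance. *)
Lemma base_power_inj c : 1 < c -> {in is_base &, injective (base_power c)}.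
Proof.
move=> c1.
suff H k k' : is_base k -> is_base k' -> k < k' ->
    base_power c k <> base_power c k'.
  by move=> k k' bk bk' E; case: (ltngtP k k') => // lt; case: (H _ _ _ _ lt).
move=> /is_baseP[j lt_k] /is_baseP[j' lt_k'] lt_kk'.
have h0 : 0 < 2 ^ j by rewrite expn_gt0.
rewrite /base_power (@base_expE k j) ?(@base_expE k' j'); try lia.
move=> E; have /eqP := congr1 size E; rewrite !size_Doubling_factor.
rewrite eqn_pmul2l ?eqn_exp2l //; last by lia.
move=> /eqP jj'; move: E lt_k'; rewrite -jj' => /Doubling_factor_eqP E lt_k'.
apply: (@no_short_repeats k (k' - k) j); [lia|lia|].
move=> i lt_i; rewrite E; last by nia.
by congr D; lia.
Qed.

(** * Counting the bases up to N *)

Definition bases N := [seq k <- iota 1 N | is_base k].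

Lemma mem_bases N k : (k \in bases N) = is_base k && (k <= N).
Proof.
rewrite mem_filter mem_iota; case: (boolP (is_base k)) => //= bk.
by have := bk; rewrite /is_base; lia.
Qed.

Lemma powers_beginningE c N : 1 < c <= 3 ->
  powers_beginning c N =
  [set` [fset u in map (base_power c) (bases N)]%fset]%classic.
Proof.
move=> c23; apply/seteqP; split=> u /=; rewrite inE.
  move=> /(powers_beginning_base c23)[k bk ->].
  by apply: map_f; rewrite mem_bases.
by move=> /mapP[k]; rewrite mem_bases => /andP[bk kN] ->; apply: base_power_mem.
Qed.

Lemma finite_powers_beginning c N :
  1 < c <= 3 -> finite_set (powers_beginning c N).
Proof. by move=> c23; rewrite powers_beginningE. Qed.

Lemma card_powers_beginning c N : 1 < c <= 3 ->
  #|` fset_set (powers_beginning c N)| = size (bases N).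
Proof.
move=> c23; rewrite powers_beginningE // set_fsetK card_fseq undup_id ?size_map //.
rewrite map_inj_in_uniq ?filter_uniq ?iota_uniq // => k k'.
rewrite !mem_bases => /andP[bk _] /andP[bk' _].
by apply: (base_power_inj _ bk bk'); case/andP: c23.
Qed.

Lemma num_squaresE N : num_squares N = size (bases N).
Proof. by rewrite /num_squares squares_beginningE card_powers_beginning. Qed.

Lemma num_squaresS N : num_squares N.+1 = num_squares N + is_base N.+1.
Proof.
rewrite !num_squaresE /bases -(addn1 N) iotaD filter_cat size_cat /= add1n addn1.
by case: (is_base _).
Qed.

Theorem mainTheorem5 :
  (forall N : nat, 1 <= N -> finite_set (squares_beginning N)) /\
  (forall m N : nat, 1 <= m ->
     (2 ^ m <= N < 3 * 2 ^ m.-1 ->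
        ((num_squares N.+1)%:Z - (num_squares N)%:Z = 1)%R) /\
     (3 * 2 ^ m.-1 <= N < 2 ^ m.+1 ->
        ((num_squares N.+1)%:Z - (num_squares N)%:Z = 0)%R)) /\
  (forall N : nat, 1 <= N ->
     finite_set (cubes_beginning N) /\ num_cubes N = num_squares N).
Proof.
split; [|split] => [N _|[//|j] N _|N _].
- by rewrite squares_beginningE; exact: finite_powers_beginning.
(* With m = j + 1, the first range of N says exactly that 2 * 2 ^ j < N + 1 <= 3 * 2 ^ j. *)
- rewrite num_squaresS !expnS /=; split=> lt_N.
    have -> : is_base N.+1 by apply/is_baseP; exists j; lia.
    by lia.
  suff -> : is_base N.+1 = false by lia.
  by rewrite /is_base (@base_expE _ j); lia.
rewrite cubes_beginningE; split; first exact: finite_powers_beginning.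
by rewrite num_squaresE /num_cubes cubes_beginningE card_powers_beginning.
Qed.
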